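(* Let $\xi\prec\eta$ for some $\xi,\eta\in \mathrm{c}_{\mathrm{o}}^*$ with $\xi_n>0$ for every $n$, and let $\{m_k,t_k\}$ and $Q(\xi,\eta)$ be the sequence and the matrix canonically associated with the pair $(\xi,\eta)$ (see context). Then the following conditions are equivalent. (i) $\xi\prec_b\eta$. (ii) The set $\{k\mid m_k=t_k=1\}$ is infinite. (iii) $Q(\xi,\eta)$ is block orthostochastic.
   Context: $\mathrm{c}_{\mathrm{o}}^*$ denotes the cone of nonnegative monotone nonincreasing sequences converging to $0$ (not a dual space). For $\xi,\eta\in \mathrm{c}_{\mathrm{o}}^*$: $\xi\prec\eta$ means $\sum_{j=1}^n\xi_j\le\sum_{j=1}^n\eta_j$ for every $n\in\mathbb N$; $\xi\prec_b\eta$ (block majorization) means $\xi\prec\eta$ and $\sum_{j=1}^{n_k}\xi_j=\sum_{j=1}^{n_k}\eta_j$ for some sequence $\mathbb N\ni n_k\uparrow\infty$. Infinite matrices are identified with operators on $\ell^2$ via the standard orthonormal basis. An orthogonal matrix is a unitary matrix with real entries. A matrix $Q$ is block orthostochastic if $Q_{ij}=(L_{ij})^2$ for all $i,j$, where $L$ is a direct sum of finite orthogonal matrices. Construction of $\{m_k,t_k\}$ and $Q(\xi,\eta)$ (for $\xi,\eta\in \mathrm{c}_{\mathrm{o}}^*$, $\xi\prec\eta$, all $\xi_n>0$). Set $\rho(0):=\eta$. For $k\ge 1$, given the nonincreasing sequence $\rho(k-1)$, let $m_k\in\mathbb N$ be the unique positive integer with $\rho(k-1)_{m_k+1}<\xi_k\le\rho(k-1)_{m_k}$,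 let $t_k\in(0,1]$ be the unique number with $\xi_k=t_k\rho(k-1)_{m_k}+(1-t_k)\rho(k-1)_{m_k+1}$, let $\delta_k:=(1-t_k)\rho(k-1)_{m_k}+t_k\rho(k-1)_{m_k+1}$, and define $\rho(k)$ by $\rho(k)_j=\rho(k-1)_j$ for $j<m_k$, $\rho(k)_{m_k}=\delta_k$, and $\rho(k)_j=\rho(k-1)_{j+1}$ for $j>m_k$. (The process can be carried on for all $k$.) For $m\ge1$ and $0<t\le1$ let $V(m,t)$ be the $(m+1)\times(m+1)$ real orthogonal matrix whose entries are $V_{1,m}=\sqrt t$, $V_{1,m+1}=-\sqrt{1-t}$, $V_{i,i-1}=1$ for $2\le i\le m$, $V_{m+1,m}=\sqrt{1-t}$, $V_{m+1,m+1}=\sqrt t$, all other entries being $0$. With $I_n$ the $n\times n$ identity ($1\le n\le\infty$; $I_0$ is dropped), let $$W^{(n)}:=(I_{n-1}\oplus V(m_n,t_n)\oplus I_\infty)(I_{n-2}\oplus V(m_{n-1},t_{n-1})\oplus I_\infty)\cdots(I_1\oplus V(m_2,t_2)\oplus I_\infty)(V(m_1,t_1)\oplus I_\infty).$$ The first $n$ rows of $W^{(j)}$ are the same for all $j\ge n$, and $W(\xi,\eta)$ is the infinite matrix whose first $n$ rows are those of $W^{(n)}$, for every $n$; it is a co-isometry with real entries. $Q(\xi,\eta)$ is its Schur-square: $Q(\xi,\eta)_{ij}=(W(\xi,\eta)_{ij})^2$. *)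

(* Defs.v *)
From HB Require Import structures.
From mathcomp Require Import all_boot all_order all_algebra.
From mathcomp Require Import all_classical all_reals all_analysis.
From mathcomp Require Import zify ring lra.

Set Implicit Arguments.
Unset Strict Implicit.
Unset Printing Implicit Defensive.

Import Order.TTheory GRing.Theory Num.Theory.
Import numFieldNormedType.Exports.

Local Open Scope classical_set_scope.
Local Open Scope ring_scope.

(* Sequences and infinite matrices are indexed from 0: [xi n] is xi_(n+1) and
   [A i j] is A_(i+1)(j+1).  The numbers m_k keep their value, so they are
   positive, and the m_k-th term of [r] is [r m_k.-1]. *)

Definition co_star (R : realType) (xi : nat -> R) : Prop :=
  [/\ forall n, 0 <= xi n, nonincreasing_seq xi & xi @ \oo --> (0 : R)].

Definition majorized (R : realType) (xi eta : nat -> R) : Prop :=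
  forall n : nat, \sum_(j < n) xi j <= \sum_(j < n) eta j.

Definition block_majorized (R : realType) (xi eta : nat -> R) : Prop :=
  majorized xi eta /\
  exists2 n : nat -> nat,
    nondecreasing_seq n /\ n @ \oo --> \oo &
    forall k, \sum_(j < n k) xi j = \sum_(j < n k) eta j.

(* One step of the construction: [r] is rho(k-1) and [x] is xi_k.  [xget]
   chooses an element of the given set, which is a singleton at every step
   (see [canonical_mP] and [canonical_tP]); its first argument is the default
   value for an empty set. *)
Section Step.
Variables (R : realType) (r : nat -> R) (x : R).

Definition step_m : nat :=
  xget 1%N [set m : nat | (0 < m)%N /\ r m < x <= r m.-1].

Definition step_t : R :=
  xget 1 [set t : R |
    0 < t <= 1 /\ x = t * r step_m.-1 + (1 - t) * r step_m].

Definition step_delta : R :=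
  (1 - step_t) * r step_m.-1 + step_t * r step_m.

Definition step_rho (j : nat) : R :=
  if (j.+1 < step_m)%N then r j
  else if j.+1 == step_m then step_delta
  else r j.+1.

End Step.

Fixpoint canonical_rho (R : realType) (xi eta : nat -> R) (k : nat) : nat -> R :=
  if k is k'.+1 then step_rho (canonical_rho xi eta k') (xi k') else eta.

(* [canonical_m xi eta k] and [canonical_t xi eta k] are m_(k+1) and
   t_(k+1). *)
Definition canonical_m (R : realType) (xi eta : nat -> R) (k : nat) : nat :=
  step_m (canonical_rho xi eta k) (xi k).

Definition canonical_t (R : realType) (xi eta : nat -> R) (k : nat) : R :=
  step_t (canonical_rho xi eta k) (xi k).

(* In 1-based terms: row 1 has sqrt t and - sqrt (1 - t) in columns m and
   m + 1, row i has a 1 in column i - 1 for 2 <= i <= m, and row m + 1 has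
   sqrt (1 - t) and sqrt t in columns m and m + 1. *)
Definition Vmx (R : realType) (m : nat) (t : R) : 'M[R]_m.+1 :=
  \matrix_(i, j)
    if i == 0%N :> nat then
      if j.+1 == m then Num.sqrt t
      else if j == m :> nat then - Num.sqrt (1 - t) else 0
    else if (i < m)%N then (i == j.+1 :> nat)%:R
    else
      if j.+1 == m then Num.sqrt (1 - t)
      else if j == m :> nat then Num.sqrt t else 0.

(* I_p (+) A (+) I_oo *)
Definition pad_id (R : realType) (p q : nat) (A : 'M[R]_q) (i j : nat) : R :=
  if (p <= i)%N && (p <= j)%N then
    match insub (i - p)%N, insub (j - p)%N with
    | Some a, Some b => A a b
    | _, _ => (i == j)%:R
    end
  else (i == j)%:R.

Definition mul_inf (R : realType) (A B : nat -> nat -> R) (i j : nat) : R :=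
  limn (series (fun l => A i l * B l j)).

Definition id_inf (R : realType) (i j : nat) : R := (i == j)%:R.

Fixpoint Wn (R : realType) (xi eta : nat -> R) (n : nat) : nat -> nat -> R :=
  if n is k.+1 then
    mul_inf (pad_id k (Vmx (canonical_m xi eta k) (canonical_t xi eta k)))
            (Wn xi eta k)
  else @id_inf R.

(* Row i (that is, the (i+1)-th one) is the same in all W^(n) with n > i. *)
Definition Wmx (R : realType) (xi eta : nat -> R) (i j : nat) : R :=
  Wn xi eta i.+1 i j.

Definition Qmx (R : realType) (xi eta : nat -> R) (i j : nat) : R :=
  Wmx xi eta i j ^+ 2.

Definition orthogonal_mx (R : realType) (n : nat) (A : 'M[R]_n) : Prop :=
  A *m A^T = 1%:M /\ A^T *m A = 1%:M.

(* [L] is the direct sum of the square matrices [B 0], [B 1], ...; the block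
   [B k] occupies the rows and columns d 0 + ... + d (k-1) + a with a < d k.
   As no block is empty, this determines every entry of [L]. *)
Definition is_direct_sum (R : realType) (d : nat -> nat)
    (B : forall k : nat, 'M[R]_(d k)) (L : nat -> nat -> R) : Prop :=
  let s k := (\sum_(l < k) d l)%N in
  [/\ forall k, (0 < d k)%N,
      forall k (a b : 'I_(d k)), L (s k + a)%N (s k + b)%N = B k a b
    & forall k l (a : 'I_(d k)) (b : 'I_(d l)),
        k != l -> L (s k + a)%N (s l + b)%N = 0].

Definition block_orthostochastic (R : realType) (Q : nat -> nat -> R) : Prop :=
  exists (d : nat -> nat) (B : forall k : nat, 'M[R]_(d k))
         (L : nat -> nat -> R),
    [/\ forall k, orthogonal_mx (B k),
        is_direct_sum B L
      & forall i j, Q i j = L i j ^+ 2].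

(* Invariant of the construction: [r] is rho(k) and [x] is the tail of xi that
   starts at xi_(k+1). *)
Definition step_inv (R : realType) (r x : nat -> R) : Prop :=
  [/\ nonincreasing_seq r, r @ \oo --> (0:R) & majorized x r].

Lemma step_mP (R : realType) (r x : nat -> R) : step_inv r x -> 0 < x 0%N ->
  (0 < step_m r (x 0%N))%N /\ r (step_m r (x 0%N)) < x 0%N <= r (step_m r (x 0%N)).-1.
Proof.
move=> [rn r0 rm] xp.
apply: (@xgetPex _ 1%N [set m : nat | (0 < m)%N /\ r m < x 0%N <= r m.-1]).
have ex : exists m, r m < x 0%N.
  have /cvgrPdist_lt/(_ _ xp)[N _ HN] := r0.
  exists N; have := HN N (leqnn N); rewrite sub0r normrN => h.
  by apply: le_lt_trans h; rewrite ler_norm.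
case: (ex_minnP ex) => m rmx mn.
have x0 : x 0%N <= r 0%N by have := rm 1%N; rewrite !big_ord_recl !big_ord0 !addr0.
exists m; case: m rmx mn => [|m] rmx mn; first by move: (lt_le_trans rmx x0); rewrite ltxx.
split => //=; rewrite rmx /=; rewrite leNgt; apply/negP => h.
by have := mn _ h; rewrite ltnn.
Qed.

Lemma step_m_uniq (R : realType) (r : nat -> R) y m m' : nonincreasing_seq r ->
  (0 < m)%N /\ r m < y <= r m.-1 -> (0 < m')%N /\ r m' < y <= r m'.-1 -> m = m'.
Proof.
move=> rn [m0 /andP[a b]] [m0' /andP[c d]].
have H p q : (0 < q)%N -> r p < y -> y <= r q.-1 -> (q <= p)%N.
  move=> q0 h k; rewrite leqNgt; apply/negP => pq.
  have : r q.-1 <= r p by apply: rn; lia.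
  by move=> /(le_trans k)/le_lt_trans/(_ h); rewrite ltxx.
by apply/eqP; rewrite eqn_leq; apply/andP; split; apply: H.
Qed.

Lemma step_tP (R : realType) (r x : nat -> R) : step_inv r x -> 0 < x 0%N ->
  let m := step_m r (x 0%N) in let t := step_t r (x 0%N) in
  0 < t <= 1 /\ x 0%N = t * r m.-1 + (1 - t) * r m.
Proof.
move=> ir xp m t; have [m0] := step_mP ir xp; rewrite -/m => /andP[h1 h2].
apply: (@xgetPex _ 1 [set t : R | 0 < t <= 1 /\ x 0%N = t * r m.-1 + (1 - t) * r m]).
have dp : 0 < r m.-1 - r m by lra.
exists ((x 0%N - r m) / (r m.-1 - r m)); split; last by field; lra.
by rewrite divr_gt0 ?ler_pdivrMr //=; lra.
Qed.

Lemma step_rho_inv (R : realType) (r x : nat -> R) : step_inv r x -> nonincreasing_seq x -> 0 < x 0%N ->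
  step_inv (step_rho r (x 0%N)) (fun n => x n.+1).
Proof.
move=> ir xn xp; have [m0] := step_mP ir xp; have [t01 xe] := step_tP ir xp.
have dE : step_delta r (x 0%N) = r (step_m r (x 0%N)).-1 + r (step_m r (x 0%N)) - x 0%N.
  by move: xe; rewrite /step_delta; move: (step_t _ _) (step_m _ _) => t m; move: (x 0%N) => y ->; ring.
rewrite /step_inv /step_rho dE; move: (step_m _ _) m0 xe dE => m m0 _ _ /andP[h1 h2].
case: ir => rn r0 rm.
split.
- apply/nonincreasing_seqP => j.
  have rs i : r i.+1 <= r i by apply: rn.
  case: ifP => a; case: ifP => b; rewrite ?rs //; try lia.
  + case: ifP => c; last by lia.
    have E : m = j.+2 by lia.
    rewrite E /= in h1 h2 *. have := rs j. have := rs j.+1. lra.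
  + case: ifP => c; first by lia.
    case: ifP => d; last exact: rs.
    have e : m = j.+1 by lia. rewrite e /= in h1 h2 *. have := rs j.+1. lra.
- have : (fun n => r n.+1) @ \oo --> (0:R) by rewrite (cvg_shiftS r).
  apply: cvg_trans. apply: near_eq_cvg. near=> n.
  have : (m <= n)%N by near: n; exists m.
  move=> mn /=. case: ifP; [lia|]. case: ifP; [lia|]. by [].
- move=> n. case: (leqP m n) => h.
  + suff -> : \sum_(j < n) (if (j.+1 < m)%N then r j else if j.+1 == m then r m.-1 + r m - x 0%N else r j.+1)
     = \sum_(j < n.+1) r j - x 0%N.
      have := rm n.+1; rewrite big_ord_recl /=.
      under eq_bigr do rewrite /bump /= add1n. lra.
    elim: n h => [|n IH] h; first by lia.
    rewrite big_ord_recr /=. case: (leqP m n) => g.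
      rewrite IH // !big_ord_recr /=. case: ifP; [lia|]. case: ifP; [lia|]. move=> _ _. ring.
    have -> : m = n.+1 by lia.
    rewrite ltnn eqxx /= !big_ord_recr /=.
    under eq_bigr => i _ do rewrite ltnS ltn_ord.
    ring.
  + apply: ler_sum => i _. have li := ltn_ord i. case: ifP => a; last by lia.
    apply: le_trans (xn 0%N i.+1 _) _ => //. apply: le_trans h2 _. apply: rn; lia.
Unshelve. all: by end_near.
Qed.

Lemma canonical_inv (R : realType) (xi eta : nat -> R) : co_star xi -> co_star eta ->
  majorized xi eta -> (forall n, 0 < xi n) -> forall k,
  step_inv (canonical_rho xi eta k) (fun n => xi (k + n)%N).
Proof.
move=> [_ xn _] [_ en e0] mj xp; elim=> [|k IH]; first by split.
have := step_rho_inv IH; rewrite /= addn0 => /(_ _ (xp k)).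
rewrite (_ : (fun n => xi (k.+1 + n)%N) = (fun n => xi (k + n.+1)%N)).
  by apply => a b ab; apply: xn; rewrite leq_add2l.
by apply/funext => n; rewrite addSnnS.
Qed.

Lemma canonical_mP (R : realType) (xi eta : nat -> R) :
  co_star xi -> co_star eta -> majorized xi eta -> (forall n, 0 < xi n) ->
  forall k, let r := canonical_rho xi eta k in
  [set m : nat | (0 < m)%N /\ r m < xi k <= r m.-1] =
  [set canonical_m xi eta k].
Proof.
move=> cx ce mj xp k r.
have ir := canonical_inv cx ce mj xp k; have := step_mP ir (xp _).
rewrite addn0 => H; apply/seteqP; split => m /=; last by move=> ->.
by case: ir => rn _ _ Hm; exact: step_m_uniq rn Hm H.
Qed.

Lemma canonical_tP (R : realType) (xi eta : nat -> R) :
  co_star xi -> co_star eta -> majorized xi eta -> (forall n, 0 < xi n) ->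
  forall k, let r := canonical_rho xi eta k in let m := canonical_m xi eta k in
  [set t : R | 0 < t <= 1 /\ xi k = t * r m.-1 + (1 - t) * r m] =
  [set canonical_t xi eta k].
Proof.
move=> cx ce mj xp k r m.
have ir := canonical_inv cx ce mj xp k.
have := step_mP ir (xp _); have := step_tP ir (xp _).
rewrite addn0 => H [_ /andP[h1 h2]]; apply/seteqP; split => t /=; last first.
  by move=> ->.
move=> [_ e]; move: H => [_]; rewrite e.
rewrite -/(canonical_m xi eta k) -/(canonical_t xi eta k) -/r -/m in h1 h2 *.
rewrite -e -/(canonical_t xi eta k) => e'.
have dn : r m.-1 - r m != 0 by rewrite subr_eq0 gt_eqF // (lt_le_trans h1).
by apply: (mulIf dn); lra.
Qed.

(* Main.v *)
Require Import Defs.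
From HB Require Import structures.
From mathcomp Require Import all_boot all_order all_algebra.
From mathcomp Require Import all_classical all_reals all_analysis.
From mathcomp Require Import zify ring lra.

(** Call [n] a block end if the [n]-th partial sums of [xi] and [eta] agree and
    [eta_(n+1) < xi_n].  Following the partial sums of [rho(k)] from stage to
    stage shows that [n] is a block end iff [m_n = t_n = 1]; and among
    infinitely many indices of equality infinitely many are block ends, because
    the first equality after a strict inequality is one (and if [xi] and [eta]
    eventually coincide, every later strict drop of [xi] gives one).  This
    settles (i) and (ii).

    If [n] is a block end, the factors of [W^(n)] do not mix the first [n]
    coordinates with the others, so that [W] splits at [n]; cutting [W] at
    infinitely many block ends gives (iii), with [L = W].  Conversely, the rows
    of [W^(k)] beyond the [k]-th have disjoint supports, hence squaring entries
    commutes with the construction and [xi = Q eta].  If [Q] is block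
    orthostochastic, its diagonal blocks are doubly stochastic, and summing
    [xi = Q eta] over the first blocks yields (i). *)

Import Order.TTheory GRing.Theory Num.Theory.
Import numFieldNormedType.Exports.

Local Open Scope classical_set_scope.
Local Open Scope ring_scope.

(** * Multiplication by the sparse factors of [W] *)

Lemma mul_inf_two {R : realType} {A : nat -> nat -> R} (B : nat -> nat -> R)
    {i p q : nat} {a b : R} (j : nat) :
  (forall l, A i l = a * (l == p)%:R + b * (l == q)%:R) ->
  mul_inf A B i j = a * B p j + b * B q j.
Proof.
move=> Ai; apply/cvg_lim => //.
apply: cvg_near_cst; near=> N.
have pN : (p < N)%N by near: N; exists p.+1.
have qN : (q < N)%N by near: N; exists q.+1.
rewrite /series /= big_mkord.
under eq_bigr do rewrite Ai mulrDl -!mulrA.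
rewrite big_split -!mulr_sumr /=.
have pick n : (n < N)%N -> \sum_(l < N) (l == n :> nat)%:R * B l j = B n j.
  move=> nN; rewrite (bigD1 (Ordinal nN)) //= eqxx mul1r big1 ?addr0 // => l.
  by rewrite -val_eqE => /negbTE /= ->; rewrite mul0r.
by rewrite !pick.
Unshelve. all: by end_near.
Qed.

Lemma pad_id_corner {R : realType} (p : nat) {q : nat} (A : 'M[R]_q) (a b : 'I_q) :
  pad_id p A (p + a)%N (p + b)%N = A a b.
Proof. by rewrite /pad_id !leq_addr /= !addKn !valK. Qed.

Lemma pad_id_out {R : realType} (p : nat) {q : nat} (A : 'M[R]_q) (i j : nat) :
  ~~ [&& p <= i, p <= j, i < p + q & j < p + q]%N ->
  pad_id p A i j = (i == j)%:R.
Proof.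
rewrite /pad_id; case: ifP => // /andP[pi pj]; rewrite pi pj /= => h.
case: insubP => [a ia _|//]; case: insubP => [b jb _|//].
by move: h ia jb; lia.
Qed.

(** A row of a factor has at most two nonzero entries; in this form [mul_inf_two] turns the infinite
    product into a two-term combination of rows. *)
Lemma pad_id_Vmx {R : realType} (k m : nat) (t : R) (i l : nat) : (0 < m)%N ->
  pad_id k (Vmx m t) i l =
    if i == k then
      Num.sqrt t * (l == (k + m).-1)%:R + - Num.sqrt (1 - t) * (l == (k + m)%N)%:R
    else if (i == k + m)%N then
      Num.sqrt (1 - t) * (l == (k + m).-1)%:R + Num.sqrt t * (l == (k + m)%N)%:R
    else if (k < i < k + m)%N then (l == i.-1)%:R
    else (l == i)%:R.
Proof.
move=> m0.
have [h|h] := boolP [&& k <= i, k <= l, i < k + m.+1 & l < k + m.+1]%N; last first.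
  rewrite pad_id_out //.
  repeat (case: ifP => ?); rewrite 1?eq_sym; repeat case: eqP => ?; try lia;
    by rewrite ?mulr0 ?addr0.
case/and4P: h => ki kl im lm.
have ai : (i - k < m.+1)%N by lia.
have bl : (l - k < m.+1)%N by lia.
have := pad_id_corner k (Vmx m t) (Ordinal ai) (Ordinal bl).
rewrite /= !subnKC // => ->; rewrite mxE /=.
rewrite (_ : (i - k == 0)%N = (i == k)); last by lia.
rewrite (_ : ((l - k).+1 == m)%N = (l == (k + m).-1)); last by lia.
rewrite (_ : ((l - k) == m)%N = (l == (k + m)%N)); last by lia.
rewrite (_ : (i - k < m)%N = (i != k + m)%N); last by lia.
rewrite (_ : (k < i < k + m)%N = (i != k) && (i != k + m)%N); last by lia.
case: (i =P k) => /= ik; last case: (i =P (k + m)%N) => /= ikm.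
- case: (l =P (k + m).-1) => h1; case: (l =P (k + m)%N) => h2; try lia;
    by rewrite ?mulr1 ?mulr0 ?addr0 ?add0r.
- case: (l =P (k + m).-1) => h1; case: (l =P (k + m)%N) => h2; try lia;
    by rewrite ?mulr1 ?mulr0 ?addr0 ?add0r.
- by congr (_%:R); lia.
Qed.

(** * Partial sums of [canonical_rho] and block ends *)

Lemma sum_step_rho_lt {R : realType} (r : nat -> R) (x : R) (n : nat) :
  (n < step_m r x)%N -> \sum_(j < n) step_rho r x j = \sum_(j < n) r j.
Proof.
move=> nm; apply: eq_bigr => -[j jn] _ /=; rewrite /step_rho.
by case: ifP => //; lia.
Qed.

(** With [m] for [step_m r x], [step_delta r x] equals [r m.-1 + r m - x]: a step merges two
    adjacent terms into one and removes exactly [x] from the total. *)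
Lemma sum_step_rho_ge {R : realType} (r : nat -> R) (x : R) (n : nat) :
  (0 < step_m r x)%N ->
  x = step_t r x * r (step_m r x).-1 + (1 - step_t r x) * r (step_m r x) ->
  (step_m r x <= n)%N ->
  \sum_(j < n) step_rho r x j = \sum_(j < n.+1) r j - x.
Proof.
move=> m0 xE; elim: n => [|n IH] mn; first by lia.
rewrite big_ord_recr /=; have [mn'|mn'] := leqP (step_m r x) n.
  rewrite IH // [in RHS]big_ord_recr /= /step_rho.
  case: ifP; [lia|move=> _]; case: ifP; [lia|move=> _]; ring.
have mE : step_m r x = n.+1 by lia.
rewrite sum_step_rho_lt // /step_rho mE ltnn eqxx /step_delta mE !big_ord_recr /=.
by rewrite [in RHS]xE mE /=; ring.
Qed.

(* Equality of the [p]-th partial sums at stage [k], together with the strict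
   drop that makes [k + p] the end of a block. *)
Definition block_end {R : realType} (xi eta : nat -> R) (k p : nat) :=
  let r := canonical_rho xi eta k in
  \sum_(j < p) r j = \sum_(j < p) xi (k + j)%N /\ r p < xi (k + p).-1.

Section Canonical.
Context {R : realType} {xi eta : nat -> R}.
Hypotheses (hxi : co_star xi) (heta : co_star eta).
Hypotheses (hmaj : majorized xi eta) (hpos : forall n, 0 < xi n).

Local Notation rho := (canonical_rho xi eta).
Local Notation m := (canonical_m xi eta).
Local Notation t := (canonical_t xi eta).

Let xi_le i j : (i <= j)%N -> xi j <= xi i.
Proof. by case: hxi => _ h _; apply: h. Qed.

Let rho_le k i j : (i <= j)%N -> rho k j <= rho k i.
Proof. by case: (canonical_inv hxi heta hmaj hpos k) => h _ _; apply: h. Qed.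

Let rho_maj k n : \sum_(j < n) xi (k + j)%N <= \sum_(j < n) rho k j.
Proof. by case: (canonical_inv hxi heta hmaj hpos k) => _ _ h; apply: h. Qed.

Lemma canonical_m_spec k : (0 < m k)%N /\ rho k (m k) < xi k <= rho k (m k).-1.
Proof.
have : [set m k] (m k) by [].
by rewrite -(canonical_mP hxi heta hmaj hpos).
Qed.

Lemma canonical_t_spec k :
  0 < t k <= 1 /\ xi k = t k * rho k (m k).-1 + (1 - t k) * rho k (m k).
Proof.
have : [set t k] (t k) by [].
by rewrite -(canonical_tP hxi heta hmaj hpos).
Qed.

Lemma sum_rho_lt k n : (n < m k)%N ->
  \sum_(j < n) rho k.+1 j = \sum_(j < n) rho k j.
Proof. exact: sum_step_rho_lt. Qed.

Lemma sum_rho_ge k n : (m k <= n)%N ->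
  \sum_(j < n) rho k.+1 j = \sum_(j < n.+1) rho k j - xi k.
Proof.
by apply: sum_step_rho_ge; [case: (canonical_m_spec k)|case: (canonical_t_spec k)].
Qed.

Local Notation block_end := (@block_end R xi eta).

Let sum_xiS k p : \sum_(j < p.+1) xi (k + j)%N = xi k + \sum_(j < p) xi (k.+1 + j)%N.
Proof.
rewrite big_ord_recl /= addn0; congr (_ + _).
by apply: eq_bigr => j _; rewrite /bump /= addnA addn1.
Qed.

(** The stage advances while the absolute end [k + p.+1] stays fixed. The bounds on [m k] and [t k]
    serve later to confine the factors of [W] to a block. *)
Lemma block_end_step k p : block_end k p.+1 ->
  [/\ (m k <= p.+1)%N, m k = p.+1 -> t k = 1 & block_end k.+1 p].
Proof.
move=> [sE]; rewrite addnS /= => lt_p.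
have [m0 /andP[mlt mle]] := canonical_m_spec k.
have [/andP[t0 t1] xE] := canonical_t_spec k.
have xkp : xi (k + p)%N <= xi k by apply: xi_le; lia.
(* Otherwise [xi k <= rho k (m k).-1 <= rho k p.+1 < xi (k + p) <= xi k]. *)
have mp : (m k <= p.+1)%N.
  rewrite leqNgt; apply/negP => pm.
  have : rho k (m k).-1 <= rho k p.+1 by apply: rho_le; lia.
  lra.
have [mp'|mp'] := leqP (m k) p.
  split => //; first by lia.
  split.
    by rewrite sum_rho_ge // sE sum_xiS; ring.
  rewrite addSn /= /step_rho -/(m k).
  by case: ifP; [lia|move=> _]; case: ifP; [lia|].
have mE : m k = p.+1 by lia.
have s1 : \sum_(j < p) rho k.+1 j = \sum_(j < p) rho k j.
  by apply: sum_rho_lt; lia.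
(* Majorization at stage [k.+1] bounds the first [p] terms of [rho k] from below by the terms of
   [xi] after [xi k], so equal totals leave [rho k p <= xi k]. *)
have := rho_maj k.+1 p; rewrite s1 => s2.
rewrite mE /= in mlt mle xE.
have sE' : \sum_(j < p) rho k j + rho k p = xi k + \sum_(j < p) xi (k.+1 + j)%N.
  by rewrite -sum_xiS -sE [RHS]big_ord_recr.
have rE : rho k p = xi k by lra.
have tE : t k = 1.
  have : (1 - t k) * (rho k p - rho k p.+1) = 0 by lra.
  by move/eqP; rewrite mulf_eq0 => /orP[] /eqP; lra.
split => //; split; first by rewrite s1; lra.
rewrite addSn /= /step_rho -/(m k) mE ltnn eqxx /step_delta -/(m k) -/(t k) mE tE /=.
by lra.
Qed.

(** At least one term must remain at stage [k.+1]: for an empty remainder the equality of sums is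
    void and would say nothing about stage [k]. *)
Lemma block_end_unstep k p : block_end k.+1 p.+1 -> block_end k p.+2.
Proof.
move=> [sE]; rewrite addSn /= addnS => lt_p.
have [m0 /andP[mlt mle]] := canonical_m_spec k.
have [/andP[t0 t1] xE] := canonical_t_spec k.
rewrite /block_end !addnS /=.
have xkp : xi (k + p).+1 <= xi k by apply: xi_le; lia.
rewrite /step_rho -/(m k) in lt_p; move: lt_p.
case: ifP => [pm lt_p|/negbT pm].
  have : rho k (m k).-1 <= rho k p.+1 by apply: rho_le; lia.
  lra.
case: ifP => [/eqP mE|/negbT pm'] lt_p; last first.
  split; last exact: lt_p.
  rewrite sum_xiS -sE sum_rho_ge; last by lia.
  ring.
rewrite /step_delta -/(m k) -/(t k) -mE /= in lt_p.
rewrite -mE /= in mlt mle xE.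
have s1 : \sum_(j < p.+1) rho k j = \sum_(j < p.+1) xi (k.+1 + j)%N.
  by rewrite -sE; apply/esym/sum_rho_lt; lia.
(* The terms of the one sum are at most [xi k] and those of the other at least
   [rho k p.+1 >= xi k]; the sums being equal, so are all the terms. *)
have xi_ub (i : 'I_p.+1) : xi (k.+1 + i)%N <= xi k by apply: xi_le; lia.
have rho_lb (i : 'I_p.+1) : rho k p.+1 <= rho k i by apply: rho_le; apply: ltnW.
have c1 : \sum_(j < p.+1) xi (k.+1 + j)%N <= \sum_(j < p.+1) xi k by apply: ler_sum.
have c2 : \sum_(j < p.+1) rho k p.+1 <= \sum_(j < p.+1) rho k j by apply: ler_sum.
have rE : rho k p.+1 = xi k.
  move: c1 c2; rewrite s1 !sumr_const !card_ord => c1 c2.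
  by apply/le_anti; rewrite mle andbT -(@ler_pMn2r _ p.+1) //; apply: le_trans c2 c1.
have sxi : \sum_(j < p.+1) xi (k.+1 + j)%N = \sum_(j < p.+1) xi k.
  by apply/le_anti; rewrite c1 -s1 -{1}rE c2.
have tE : t k = 1.
  have : (1 - t k) * (rho k p.+1 - rho k p.+2) = 0 by lra.
  by move/eqP; rewrite mulf_eq0 => /orP[] /eqP; lra.
split.
  by rewrite [RHS]sum_xiS big_ord_recr /= s1 rE addrC.
by move: lt_p; rewrite tE; lra.
Qed.

Lemma block_end_descend k j : (j <= k)%N -> block_end 0 k -> block_end j (k - j).
Proof.
elim: j => [|j IH] jk h; first by rewrite subn0.
by have := IH (ltnW jk) h; rewrite -(subnSK jk) => /block_end_step[].
Qed.

(** Both values being 1 means [rho k 1 < xi k = rho k 0], a block end of length 1 at stage [k]. It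
    is carried back to stage 0 by [block_end_unstep], and from there to stage [k] by
    [block_end_descend]. *)
Lemma canonical_reset k : (m k = 1%N /\ t k = 1) <-> block_end 0 k.+1.
Proof.
split=> [[mE tE]|h].
  have [_ xE] := canonical_t_spec k; have [_ /andP[lt1 _]] := canonical_m_spec k.
  rewrite mE tE /= in lt1 xE.
  have : block_end k 1 by rewrite /block_end !big_ord1 addn0 addn1 /=; split => //; lra.
  suff H j i : (j + i = k)%N -> block_end j i.+1 -> block_end 0 k.+1 by apply: H; lia.
  elim: j i => [|j IH] i jik; first by rewrite -jik add0n.
  by move=> /block_end_unstep; apply: IH; lia.
have := block_end_descend _ _ (leqnSn k) h; rewrite subSnn => /block_end_step[m1 t1 _].
have [m0 _] := canonical_m_spec k.
have mE : m k = 1%N by lia.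
by split => //; apply: t1.
Qed.

End Canonical.

(** * Rows of the partial products [Wn] *)

(** Eventual constancy rather than convergence: the rows involved have finite support, so no
    summability question arises. *)
Definition has_sum {R : realType} (f : nat -> R) (c : R) :=
  \forall N \near \oo, \sum_(j < N) f j = c.

Lemma has_sum_comb {R : realType} {f g : nat -> R} (a b : R) {c d : R} :
  has_sum f c -> has_sum g d ->
  has_sum (fun j => a * f j + b * g j) (a * c + b * d).
Proof.
move=> fc gd; near=> N; rewrite big_split -!mulr_sumr /=.
by congr (_ * _ + _ * _); near: N.
Unshelve. all: by end_near.
Qed.

Lemma has_sum_ext {R : realType} {f g : nat -> R} {c d : R} :
  has_sum f c -> f =1 g -> c = d -> has_sum g d.
Proof. by move=> + fg <-; have -> : f = g by exact/funext. Qed.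

Section Rows.
Context {R : realType} {xi eta : nat -> R}.
Hypotheses (hxi : co_star xi) (heta : co_star eta).
Hypotheses (hmaj : majorized xi eta) (hpos : forall n, 0 < xi n).

Local Notation rho := (canonical_rho xi eta).
Local Notation m := (canonical_m xi eta).
Local Notation t := (canonical_t xi eta).
Local Notation W := (Wn xi eta).

Let m_gt0 k : (0 < m k)%N.
Proof. by case: (canonical_m_spec hxi heta hmaj hpos k). Qed.

Let sqrt_tK k : Num.sqrt (t k) ^+ 2 = t k.
Proof.
by rewrite sqr_sqrtr //; case: (canonical_t_spec hxi heta hmaj hpos k) => /andP[/ltW].
Qed.

Let sqrt_tCK k : Num.sqrt (1 - t k) ^+ 2 = 1 - t k.
Proof.
rewrite sqr_sqrtr // subr_ge0.
by case: (canonical_t_spec hxi heta hmaj hpos k) => /andP[].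
Qed.

Lemma Wn_old k i j : (i < k)%N -> W k.+1 i j = W k i j.
Proof.
move=> ik /=; rewrite (@mul_inf_two _ _ _ i i i 1 0) ?mul1r ?mul0r ?addr0 // => l.
rewrite pad_id_Vmx // mul1r mul0r addr0.
by repeat (case: ifP => ?; first by lia).
Qed.

Lemma Wn_out k j :
  W k.+1 k j =
    Num.sqrt (t k) * W k (k + m k).-1 j - Num.sqrt (1 - t k) * W k (k + m k)%N j.
Proof.
rewrite -mulNr; apply: mul_inf_two => l.
by rewrite pad_id_Vmx // eqxx.
Qed.

(** The case split is that of [step_rho], so that rows and [rho] can be followed by one
    induction. *)
Lemma Wn_rest k i j : W k.+1 (k.+1 + i)%N j =
  if (i.+1 < m k)%N then W k (k + i)%N j
  else if i.+1 == m k then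
    Num.sqrt (1 - t k) * W k (k + i)%N j + Num.sqrt (t k) * W k (k + i).+1 j
  else W k (k + i).+1 j.
Proof.
case: ifP => h1; last case: ifP => h2.
- rewrite /= (@mul_inf_two _ _ _ _ (k + i)%N 0 1 0) ?mul1r ?mul0r ?addr0 // => l.
  rewrite pad_id_Vmx // mul1r mul0r addr0.
  case: ifP; [lia|move=> _]; case: ifP; [lia|move=> _]; case: ifP; [move=> _|lia].
  by congr (_%:R); lia.
- apply: mul_inf_two => l; rewrite pad_id_Vmx //.
  case: ifP; [lia|move=> _]; case: ifP; [move=> _|lia].
  by rewrite -(eqP h2) !addnS /=.
- rewrite /= (@mul_inf_two _ _ _ _ (k + i).+1 0 1 0) ?mul1r ?mul0r ?addr0 // => l.
  rewrite pad_id_Vmx // mul1r mul0r addr0.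
  by case: ifP; [lia|move=> _]; case: ifP; [lia|move=> _]; case: ifP; [lia|].
Qed.

Lemma Wn_stable k i j : (i < k)%N -> W k i j = Wmx xi eta i j.
Proof.
elim: k => // k IH; rewrite ltnS leq_eqVlt => /orP[/eqP->//|ik].
by rewrite Wn_old // IH.
Qed.

(* The rows not yet output stay disjointly supported; hence no two nonzero
   terms ever meet in an entry, and squaring entries commutes with the steps. *)
Lemma Wn_disjoint k i i' j : i != i' -> W k (k + i)%N j * W k (k + i')%N j = 0.
Proof.
elim: k i i' => [|k IH] i i' ii'.
  rewrite /= /id_inf; case: eqP => [|_]; case: eqP => [|_]; rewrite ?mulr0 ?mul0r //.
  by move: ii'; lia.
have D p q : p != q -> W k (k + p)%N j * W k (k + q)%N j = 0 by exact: IH.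
rewrite !Wn_rest -!addnS.
by repeat (case: ifP => ?);
  rewrite ?mulrDl ?mulrDr ?(mulrACA _ (W k _ j)) ?(mulrCA (W k _ j)) -?mulrA
    ?D ?mulr0 ?addr0 //; lia.
Qed.

(** By [Wn_disjoint] the cross term of the mixed row vanishes, and its squared coefficients
    [1 - t k] and [t k] are the weights in [step_delta]. *)
Lemma Wn_sqr_sum k i : has_sum (fun j => W k (k + i)%N j ^+ 2 * eta j) (rho k i).
Proof.
elim: k i => [|k IH] i.
  near=> N; have iN : (i < N)%N by near: N; exists i.+1.
  rewrite (bigD1 (Ordinal iN)) //= /id_inf eqxx expr1n mul1r big1 ?addr0 // => j.
  by rewrite -val_eqE eq_sym => /negbTE /= ->; rewrite expr0n mul0r.
rewrite [rho k.+1 i]/= /step_rho -/(m k) /step_delta -/(t k) -/(m k).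
case: ifP => h1; last case: ifP => h2.
- by refine (has_sum_ext (IH i) _ _) => // j; rewrite Wn_rest h1.
- rewrite -(eqP h2) [i.+1.-1]/=.
  refine (has_sum_ext (has_sum_comb (1 - t k) (t k) (IH i) (IH i.+1)) _ _) => // j.
  rewrite Wn_rest h1 h2 sqrrD !exprMn sqrt_tK sqrt_tCK mulrACA -addnS.
  rewrite Wn_disjoint; last by lia.
  by rewrite mulr0 mul0rn addr0; ring.
- by refine (has_sum_ext (IH i.+1) _ _) => // j; rewrite Wn_rest h1 h2 addnS.
Unshelve. all: by end_near.
Qed.

Lemma Qmx_eta k : has_sum (fun j => Qmx xi eta k j * eta j) (xi k).
Proof.
have [_ xE] := canonical_t_spec hxi heta hmaj hpos k.
have S i := Wn_sqr_sum k i; rewrite xE.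
refine (has_sum_ext (has_sum_comb (t k) (1 - t k) (S (m k).-1) (S (m k))) _ _) => // j.
rewrite /Qmx /Wmx Wn_out sqrrB !exprMn sqrt_tK sqrt_tCK mulrACA.
rewrite (_ : (k + m k).-1 = (k + (m k).-1)%N); last by have := m_gt0 k; lia.
rewrite Wn_disjoint; last by have := m_gt0 k; lia.
by rewrite mulr0 mul0rn subr0; ring.
Qed.

(** Each factor is orthogonal. Every new row is a combination of two old ones, so an inner product
    expands into four old ones. *)
Lemma Wn_orthonormal k i i' : has_sum (fun j => W k i j * W k i' j) (i == i')%:R.
Proof.
elim: k i i' => [|k IH] i i'.
  near=> N; have iN : (i < N)%N by near: N; exists i.+1.
  rewrite (bigD1 (Ordinal iN)) //= /id_inf eqxx mul1r big1 ?addr0 1?eq_sym // => j.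
  by rewrite -val_eqE eq_sym => /negbTE /= ->; rewrite mul0r.
(* Row [l] of [W k.+1] is [a l] times row [p l] plus [b l] times row [k + m k] of [W k]; rows that
   are only moved or kept have [a l = 1] and [b l = 0]. *)
pose a l :=
  if l == k then Num.sqrt (t k) else if (l == k + m k)%N then Num.sqrt (1 - t k) else 1.
pose b l :=
  if l == k then - Num.sqrt (1 - t k) else if (l == k + m k)%N then Num.sqrt (t k) else 0.
pose p l := if (l == k) || (l == k + m k)%N then (k + m k).-1
  else if (k < l < k + m k)%N then l.-1 else l.
have E l j : W k.+1 l j = a l * W k (p l) j + b l * W k (k + m k)%N j.
  apply: mul_inf_two => n; rewrite pad_id_Vmx // /a /b /p.
  by case: ifP => //= _; case: ifP => //= _; case: ifP => //= _; rewrite mul1r mul0r addr0.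
refine (has_sum_ext (has_sum_comb (a i) (b i)
    (has_sum_comb (a i') (b i') (IH (p i) (p i')) (IH (p i) (k + m k)%N))
    (has_sum_comb (a i') (b i') (IH (k + m k)%N (p i')) (IH (k + m k)%N (k + m k)%N))) _ _).
  by move=> j; rewrite !E; ring.
rewrite eqxx /a /b /p; have := m_gt0 k; move: (m k) (sqrt_tK k) (sqrt_tCK k) => n.
move: (Num.sqrt (t k)) (Num.sqrt (1 - t k)) (t k) => s c u sE cE n0.
case: (i =P k) => [ik|ik]; last case: (i =P (k + n)%N) => [ikn|ikn];
  last case: (ltnP k i) => [ki|ki]; last 1 first.
all: case: (i' =P k) => [ik'|ik']; last case: (i' =P (k + n)%N) => [ikn'|ikn'];
  last case: (ltnP k i') => [ki'|ki'] /=.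
all: rewrite /=; repeat (case: ifP => ?); repeat (case: eqP => ?); try lia.
all: rewrite /=; lra.
Unshelve. all: by end_near.
Qed.

End Rows.

(** * Infinite index sets and sums over blocks *)

Lemma infinite_set_natP (A : set nat) :
  infinite_set A <-> forall N, exists2 k, (N <= k)%N & A k.
Proof.
split=> [Ainf N|H].
  apply: contrapT => nex; apply: Ainf; apply: sub_finite_set (finite_II N) => k Ak /=.
  by rewrite ltnNge; apply/negP => Nk; apply: nex; exists k.
move=> /finite_seqP[s As]; have [k sk] := H (\max_(i <- s) i).+1.
rewrite As => /= ks; move: sk; rewrite leqNgt ltnS => /negP; apply.
exact: leq_bigmax_seq.
Qed.

(** The sequence starts at 0 so that its terms can serve as block boundaries. *)
Lemma unbounded_subseq {P : nat -> Prop} :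
  (forall N, exists2 k, (N <= k)%N & P k.+1) ->
  exists2 s : nat -> nat, s 0%N = 0%N & forall k, (s k < s k.+1)%N /\ P (s k.+1).
Proof.
move=> H; have [|f Hf] := @choice _ _ (fun N k => (N <= k)%N /\ P k.+1).
  by move=> N; have [k Nk Pk] := H N; exists k.
exists (fun k => iter k (fun N => (f N).+1) 0%N) => // k /=.
by have [] := Hf (iter k (fun N => (f N).+1) 0%N).
Qed.

Lemma sum_blocks {R : realType} (d : nat -> nat) (F : nat -> R) (K : nat) :
  \sum_(j < \sum_(l < K) d l) F j =
  \sum_(l < K) \sum_(b < d l) F (\sum_(i < l) d i + b)%N.
Proof.
elim: K => [|K IH]; first by rewrite !big_ord0.
by rewrite [in RHS]big_ord_recr [in LHS]big_ord_recr /= big_split_ord /= IH.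
Qed.

Lemma leq_sum_blocks {d : nat -> nat} (K : nat) :
  (forall k, 0 < d k)%N -> (K <= \sum_(l < K) d l)%N.
Proof.
move=> d0; rewrite -{1}[K]card_ord -sum1_card; exact: leq_sum.
Qed.

Lemma has_sum_block {R : realType} {d : nat -> nat} {F : nat -> R} {c : R} {k : nat} :
  (forall l, 0 < d l)%N -> has_sum F c ->
  (forall l (b : 'I_(d l)), l != k -> F (\sum_(i < l) d i + b)%N = 0) ->
  \sum_(b < d k) F (\sum_(i < k) d i + b)%N = c.
Proof.
move=> d0 [N _ HN] F0.
(* This many nonempty blocks cover at least [N] indices and include block [k]. *)
have kM : (k < maxn N k.+1)%N by rewrite leq_max ltnSn orbT.
rewrite -(HN (\sum_(l < maxn N k.+1) d l)%N) /=; last first.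
  by apply: leq_trans (leq_sum_blocks _ d0); rewrite leq_maxl.
rewrite sum_blocks (bigD1 (Ordinal kM)) //= [X in _ + X]big1 ?addr0 // => l lk.
by rewrite big1 // => b _; apply: F0; rewrite -val_eqE in lk.
Qed.

(** * The implications between the three conditions *)

Section Equivalence.
Context {R : realType} {xi eta : nat -> R}.
Hypotheses (hxi : co_star xi) (heta : co_star eta).
Hypotheses (hmaj : majorized xi eta) (hpos : forall n, 0 < xi n).

Local Notation m := (canonical_m xi eta).
Local Notation t := (canonical_t xi eta).
Local Notation W := (Wn xi eta).

Lemma block_majorized_block_end : block_majorized xi eta ->
  forall N, exists2 k, (N <= k)%N & block_end xi eta 0 k.+1.
Proof.
case: hxi => _ xin xi0; case: heta => _ etan _.
move=> [_ [n [_ ninf] nE]] N.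
pose E p := \sum_(j < p) xi j == \sum_(j < p) eta j.
have exE M : exists p, (M <= p)%N && E p.
  have /cvgnyPge/(_ M)[k _ Hk] := ninf.
  by exists (n k); rewrite Hk //=; apply/eqP.
suff [k Nk [Ek lt_k]] : exists2 k, (N <= k)%N & E k.+1 /\ eta k.+1 < xi k.
  by exists k => //; split => //; apply/esym/eqP.
have [allE|/existsNP[n1 /not_implyP[Nn1 nE1]]] := pselect (forall p, (N <= p)%N -> E p).
  suff [k Nk xik] : exists2 k, (N <= k)%N & xi k.+1 < xi k.
    exists k => //; split; first by apply: allE; lia.
    have /eqP := allE k.+2 ltac:(lia).
    rewrite big_ord_recr [in RHS]big_ord_recr /= (eqP (allE k.+1 ltac:(lia))).
    by move=> /addrI <-.
  (* Without a strict drop [xi] would be constant from [N] on, at a positive value, against its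
     limit 0. *)
  apply: contrapT => nex.
  have cst i : xi (N + i)%N = xi N.
    elim: i => [|i <-]; first by rewrite addn0.
    apply/le_anti; rewrite xin ?leq_add2l //= addnS leNgt; apply/negP => h.
    by apply: nex; exists (N + i)%N; rewrite ?leq_addr.
  have /cvgrPdist_lt/(_ _ (hpos N))[M _ HM] := xi0.
  have := HM (N + M)%N (leq_addl _ _).
  by rewrite cst sub0r normrN gtr0_norm ?ltxx.
(* [p] is the first index of equality after the strict inequality at [n1]. At its predecessor [k]
   the inequality is still strict, which forces [eta k < xi k]. *)
have [p /andP[n1p Ep] pmin] := ex_minnP (exE n1).
case: p => [|k] in n1p Ep pmin *; first by move: nE1; rewrite (_ : n1 = 0%N) //; lia.
have n1k : (n1 <= k)%N.
  by rewrite -ltnS ltn_neqAle n1p andbT; apply: contra_not_neq nE1 => ->.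
exists k; first by lia.
split => //; apply: (@le_lt_trans _ _ (eta k)); first exact: etan.
have nEk : ~~ E k by apply/negP => Ek; have := pmin k; rewrite n1k Ek ltnn => /(_ isT).
have : \sum_(j < k) xi j < \sum_(j < k) eta j by rewrite lt_neqAle nEk hmaj.
by move: Ep => /eqP; rewrite big_ord_recr [in RHS]big_ord_recr /=; lra.
Qed.

Lemma block_end_block_majorized :
  (forall N, exists2 k, (N <= k)%N & block_end xi eta 0 k.+1) -> block_majorized xi eta.
Proof.
move=> /unbounded_subseq[s s0 Hs].
have s_ge k : (k <= s k)%N.
  by elim: k => // k IH; apply: leq_ltn_trans IH _; case: (Hs k).
split => //; exists s.
  split; first by apply/nondecreasing_seqP => k; case: (Hs k) => /ltnW.
  by apply/cvgnyPge => A; exists A => // k /= /leq_trans; apply.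
by case=> [|k]; [rewrite s0 !big_ord0|case: (Hs k) => _ [+ _] => ->].
Qed.

(** Factor [k < n] acts on rows [k] to [k + m k <= n]. It reaches row [n], the first one outside the
    block, only when [t k = 1], and then its [Num.sqrt (1 - t k)] entries vanish. *)
Lemma Wmx_block_end {n : nat} : block_end xi eta 0 n ->
  (forall i j, (i < n <= j)%N -> Wmx xi eta i j = 0) /\
  (forall i j, (j < n <= i)%N -> Wmx xi eta i j = 0).
Proof.
move=> hn.
have mn k : (k < n)%N -> [/\ (0 < m k)%N, (k + m k <= n)%N & (k + m k = n)%N -> t k = 1].
  move=> kn; have [m0 _] := canonical_m_spec hxi heta hmaj hpos k.
  have := block_end_descend hxi heta hmaj hpos _ _ (ltnW kn) hn.
  rewrite -(subnSK kn) => /(block_end_step hxi heta hmaj hpos)[h1 h2 _].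
  by split => //; [|move=> h; apply: h2]; lia.
(* Stages up to [n] suffice: row [i < n] of [Wmx] is read off at stage [i.+1]. *)
have up k i j : (k <= n)%N -> (i < n <= j)%N -> W k i j = 0.
  elim: k i => [|k IH] i kn ij; first by rewrite /= /id_inf; case: eqP => //; lia.
  have {}IH p : (p < n)%N -> W k p j = 0 by move=> pn; apply: IH; lia.
  have [m0 mle mt] := mn _ kn.
  have last_row a : a = Num.sqrt (1 - t k) -> a * W k (k + m k)%N j = 0.
    move=> ->; move: mle; rewrite leq_eqVlt => /orP[/eqP e|?].
      by rewrite mt // subrr sqrtr0 mul0r.
    by rewrite IH ?mulr0 //.
  have [ik|ki|->] := ltngtP i k.
  - by rewrite Wn_old // IH //; lia.
  - rewrite -(subnKC ki) Wn_rest //.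
    case: ifP => h1; first by rewrite IH //; lia.
    case: ifP => h2; first by rewrite !IH ?mulr0 ?addr0 //; lia.
    by rewrite IH //; lia.
  - by rewrite Wn_out // last_row // IH ?mulr0 ?subr0 //; lia.
have down k i j : (j < n <= i)%N -> W k i j = 0.
  elim: k i => [|k IH] i ij; first by rewrite /= /id_inf; case: eqP => //; lia.
  have {}IH p : (n <= p)%N -> W k p j = 0 by move=> pn; apply: IH; lia.
  have [ik|ki|ik] := ltngtP i k.
  - by rewrite Wn_old // IH //; lia.
  - rewrite -(subnKC ki) Wn_rest //.
    have [nk|kn] := leqP n k.
      by case: ifP => _; [|case: ifP => _]; rewrite !IH ?mulr0 ?addr0 //; lia.
    have [m0 mle mt] := mn _ kn.
    case: ifP => h1; first by lia.
    case: ifP => h2; last by rewrite IH //; lia.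
    rewrite mt; last by lia.
    by rewrite subrr sqrtr0 mul0r IH ?mulr0 ?addr0 //; lia.
  - have [m0 _] := canonical_m_spec hxi heta hmaj hpos k.
    by rewrite ik Wn_out // !IH ?mulr0 ?subr0 //; lia.
by split=> i j ij; [apply: up|apply: down] => //; lia.
Qed.

Lemma block_end_block_orthostochastic :
  (forall N, exists2 k, (N <= k)%N & block_end xi eta 0 k.+1) ->
  block_orthostochastic (Qmx xi eta).
Proof.
move=> /unbounded_subseq[s s0 Hs].
have s_mono : {homo s : i j / (i <= j)%N}.
  by apply: (@homo_leq _ _ leq) => [//|? ? ?|k]; [exact: leq_trans|case: (Hs k) => /ltnW].
pose d k := (s k.+1 - s k)%N.
have d0 k : (0 < d k)%N by rewrite subn_gt0; case: (Hs k).
have sd k : (\sum_(l < k) d l)%N = s k.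
  elim: k => [|k IH]; first by rewrite big_ord0 s0.
  by rewrite big_ord_recr /= IH subnKC //; case: (Hs k) => /ltnW.
have sdlt k (a : 'I_(d k)) : (s k + a < s k.+1)%N by case: a => a /=; rewrite /d; lia.
have off k l (a : 'I_(d k)) (b : 'I_(d l)) : k != l ->
    Wmx xi eta (s k + a)%N (s l + b)%N = 0.
  have := sdlt k a; have := sdlt l b; rewrite neq_ltn => bl ak /orP[kl|lk].
    have [_ /Wmx_block_end[-> //]] := Hs k.
    by have := s_mono k.+1 l kl; lia.
  have [_ /Wmx_block_end[_ ->//]] := Hs l.
  by have := s_mono l.+1 k lk; lia.
exists d, (fun k => \matrix_(a < d k, b < d k) Wmx xi eta (s k + a)%N (s k + b)%N),
  (Wmx xi eta).
split=> // [k|]; last first.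
  split=> // [k a b|k l a b kl]; first by rewrite sd mxE.
  by rewrite !sd off.
(* For a finite square block orthonormal rows suffice; they come from those of [W], whose rows in
   this block vanish outside it. *)
suff BBt : (\matrix_(a < d k, b < d k) Wmx xi eta (s k + a)%N (s k + b)%N) *m
    (\matrix_(a < d k, b < d k) Wmx xi eta (s k + a)%N (s k + b)%N)^T = 1%:M.
  by split=> //; apply: mulmx1C.
apply/matrixP => a b; rewrite !mxE.
pose F j := Wmx xi eta (s k + a)%N j * Wmx xi eta (s k + b)%N j.
have hF : has_sum F (a == b)%:R.
  rewrite -val_eqE -(eqn_add2l (s k)).
  (* A stage at which both rows are already final. *)
  pose n := (maxn (s k + a) (s k + b)).+1.
  apply: has_sum_ext (Wn_orthonormal hxi heta hmaj hpos n _ _) _ (erefl _) => j.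
  by rewrite !Wn_stable // ltnS ?leq_maxl ?leq_maxr.
rewrite -(has_sum_block (k := k) d0 hF) => [|l c lk]; last first.
  by rewrite /F sd off ?mul0r // eq_sym.
by rewrite sd; apply: eq_bigr => c _; rewrite !mxE.
Qed.

Lemma block_orthostochastic_block_majorized :
  block_orthostochastic (Qmx xi eta) -> block_majorized xi eta.
Proof.
move=> [d [B [L [Borth [d0 LB L0] QL]]]]; split => //.
exists (fun K => \sum_(l < K) d l)%N.
  split; first by apply/nondecreasing_seqP => k; rewrite big_ord_recr leEnat leq_addr.
  by apply/cvgnyPge => A; exists A => // k /= /leq_trans; apply; exact: leq_sum_blocks.
move=> K; rewrite !sum_blocks; apply: eq_bigr => k _.
transitivity (\sum_(a < d k) \sum_(b < d k) B k a b ^+ 2 * eta (\sum_(i < k) d i + b)%N).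
  apply: eq_bigr => a _.
  have := Qmx_eta hxi heta hmaj hpos (\sum_(i < k) d i + a)%N.
  move=> /(has_sum_block (k := k) d0) <-.
    by apply: eq_bigr => b _; rewrite QL LB.
  by move=> l b lk; rewrite QL L0 1?eq_sym // expr0n mul0r.
(* The squares in column [b] sum to the diagonal entry of [(B k)^T *m B k], which is 1. *)
rewrite exchange_big; apply: eq_bigr => b _; rewrite -mulr_suml.
have [_ /matrixP/(_ b b)] := Borth k; rewrite !mxE eqxx => BtB.
rewrite (_ : \sum_(a < d k) _ = 1) ?mul1r // -[RHS]BtB.
by apply: eq_bigr => a _; rewrite mxE expr2.
Qed.

End Equivalence.

Theorem proposition4p4 (R : realType) (xi eta : nat -> R)
    (hxi : co_star xi) (heta : co_star eta)
    (hmaj : majorized xi eta) (hpos : forall n : nat, 0 < xi n) :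
  (block_majorized xi eta <->
   infinite_set
     [set k : nat | canonical_m xi eta k = 1%N /\ canonical_t xi eta k = 1]) /\
  (infinite_set
     [set k : nat | canonical_m xi eta k = 1%N /\ canonical_t xi eta k = 1] <->
   block_orthostochastic (Qmx xi eta)).
Proof.
have -> : [set k : nat | canonical_m xi eta k = 1%N /\ canonical_t xi eta k = 1] =
    [set k | block_end xi eta 0 k.+1].
  by apply/seteqP; split => k /(canonical_reset hxi heta hmaj hpos).
rewrite infinite_set_natP.
have to_ends := block_majorized_block_end hxi heta hmaj hpos.
split; split.
- exact: to_ends.
- exact: block_end_block_majorized.
- exact: block_end_block_orthostochastic.
(* From (iii) the block ends are reached through (i). *)
- by move=> /(block_orthostochastic_block_majorized hxi heta hmaj hpos)/to_ends.
Qed.
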